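(* Let $\mathcal{L}$ be a complete modular lattice and let $\mathfrak{m}$ be a submonoid with zero of $\mathrm{End}_{lin}(\mathcal{L})$ containing all the projections. The following conditions are equivalent: (a) $\mathcal{L}$ is dual-$\mathfrak{m}$-Rickart. (b) $\mathcal{L}$ is $\mathfrak{m}$-$\mathcal{T}$-lifting and $\mathfrak{m}$-$\mathcal{T}$-nonsingular.
   Context: $\mathbf{0},\mathbf{1}$ denote the least and greatest elements; $[a,b]=\{x: a\le x\le b\}$. An element $x$ has a complement if there is $x'$ with $x\wedge x'=\mathbf{0}$, $x\vee x'=\mathbf{1}$; $C(\mathcal{L})$ is the set of elements of $\mathcal{L}$ having a complement. An element $x$ of a bounded lattice is superfluous if $x\vee y=\mathbf{1}$ implies $y=\mathbf{1}$ (in an interval $[\mathbf{0},c']$ the top element is $c'$). Linear morphism: a map $\varphi:\mathcal{L}\to\mathcal{L}'$ between bounded lattices is linear if there exist $\ker_\varphi\in\mathcal{L}$ and $a'\in\mathcal{L}'$ such that (1) $\varphi(x)=\varphi(x\vee\ker_\varphi)$ for all $x$; (2) $\varphi$ restricts to a lattice isomorphism $[\ker_\varphi,\mathbf{1}]\to[\mathbf{0},a']$ (so $a'=\varphi(\mathbf{1})$). $\mathrm{End}_{lin}(\mathcal{L})$ is the monoid of linear morphisms $\mathcal{L}\to\mathcal{L}$ under composition; its zero $0$ is the constant map $\mathbf{0}$. A submonoid with zero contains the identity and the zero morphism. For $x$ with complement $x'$, the projection $\pi_x:\mathcal{L}\to\mathcal{L}$ (with respect to $x'$) is $\pi_x(a)=(a\vee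 x')\wedge x$. $\mathfrak{m}$ contains all the projections if $\pi_x\in\mathfrak{m}$ for every $x\in C(\mathcal{L})$ (and every choice of complement $x'$). $\mathcal{L}$ is dual-$\mathfrak{m}$-Rickart if $\varphi(\mathbf{1})$ has a complement for all $\varphi\in\mathfrak{m}$. $\mathcal{L}$ is $\mathfrak{m}$-$\mathcal{T}$-lifting if for every $\varphi\in\mathfrak{m}$ there is $c\in C(\mathcal{L})$ with a complement $c'$ such that $c\le\varphi(\mathbf{1})$ and $\varphi(\mathbf{1})\wedge c'$ is superfluous in $[\mathbf{0},c']$. $\mathcal{L}$ is $\mathfrak{m}$-$\mathcal{T}$-nonsingular if for every $\varphi\in\mathfrak{m}$, $\varphi(\mathbf{1})$ superfluous in $\mathcal{L}$ implies $\varphi=0$. *)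

(* Defs.v *)
From mathcomp Require Import all_boot all_order all_algebra.
From mathcomp Require Import boolp classical_sets functions.

Set Implicit Arguments.
Unset Strict Implicit.
Unset Printing Implicit Defensive.

Import Order.Theory.
Local Open Scope order_scope.

(* Sets of elements of a lattice are Prop-valued ([set L] of classical_sets);
   [ `[a, b]%classic ] is the interval {x | a <= x <= b} as such a set. *)

Definition complete_lattice d (L : latticeType d) : Prop :=
  forall A : set L, (supremums A !=set0 /\ infimums A !=set0)%classic.

Definition modular_lattice d (L : latticeType d) : Prop :=
  forall a b c : L, a <= c -> a `|` (b `&` c) = (a `|` b) `&` c.

Section Elements.
Context {d : Order.disp_t} {L : tbLatticeType d}.
Implicit Types x y c : L.

Definition is_complement x x' : Prop := x `&` x' = \bot /\ x `|` x' = \top.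

Definition has_complement x : Prop := exists x', is_complement x x'.

Definition superfluous x : Prop := forall y, x `|` y = \top -> y = \top.

Definition superfluous_below c x : Prop :=
  (`[\bot, c]%classic x) /\
  forall y, `[\bot, c]%classic y -> x `|` y = c -> y = c.

(* The projection onto [x] with respect to a complement [x'] of [x]. *)
Definition lproj x x' : L -> L := fun a => (a `|` x') `&` x.

Definition lzero : L -> L := fun=> \bot.

End Elements.

(* [A] and [B] are meant to be sublattices, here intervals. *)
Definition lattice_iso_on d d' (L : latticeType d) (L' : latticeType d')
    (A : set L) (B : set L') (f : L -> L') : Prop :=
  [/\ set_bij A B f,
      {in A &, {morph f : x y / x `&` y >-> x `&` y}} &
      {in A &, {morph f : x y / x `|` y >-> x `|` y}}].

Definition linear_morphism d d' (L : tbLatticeType d) (L' : tbLatticeType d')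
    (phi : L -> L') : Prop :=
  exists (k : L) (a' : L'),
    (forall x, phi x = phi (x `|` k)) /\
    lattice_iso_on `[k, \top]%classic `[\bot, a']%classic phi.

Definition End_lin d (L : tbLatticeType d) : set (L -> L) :=
  [set phi | linear_morphism phi]%classic.

Record submonoid_with_zero d (L : tbLatticeType d) (m : set (L -> L)) : Prop :=
  SubmonoidWithZero {
    submonoid_sub : (m `<=` @End_lin d L)%classic;
    submonoid_id : m idfun;
    submonoid_comp : forall phi psi, m phi -> m psi -> m (phi \o psi);
    submonoid_zero : m lzero
  }.

Section Endomorphisms.
Context {d : Order.disp_t} {L : tbLatticeType d}.
Implicit Types m : set (L -> L).

Definition contains_projections m : Prop :=
  forall x x' : L, is_complement x x' -> m (lproj x x').

Definition dual_Rickart m : Prop :=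
  forall phi, m phi -> has_complement (phi \top).

Definition T_lifting m : Prop :=
  forall phi, m phi ->
    exists c c' : L, [/\ is_complement c c', c <= phi \top &
                         superfluous_below c' (phi \top `&` c')].

Definition T_nonsingular m : Prop :=
  forall phi, m phi -> superfluous (phi \top) -> phi = lzero.

End Endomorphisms.

(* Main.v *)
Require Import Defs.
From mathcomp Require Import all_boot all_order all_algebra.
From mathcomp Require Import boolp classical_sets functions.

(** If [phi \top] has a complement [c'], then [c = phi \top] witnesses the
    lifting property, because [phi \top `&` c' = \bot]; and if [phi \top] is
    moreover superfluous, then [c' = \top], which forces [phi \top = \bot], hence
    [phi = 0] because a linear morphism is bounded by its value at [\top].

    Conversely, let [c, c'] be given by the lifting property for [phi].  The
    composite [psi] of [phi] with the projection onto [c'] along [c] lies in [m],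
    and [psi \top = phi \top `&` c'] because [c <= phi \top].  Modularity
    ([superfluous_below_superfluous]) turns a superfluous element of
    [[\bot, c']] into one of the whole lattice, so nonsingularity gives
    [psi = 0].  Thus [phi \top `&` c' = \bot], while
    [phi \top `|` c' >= c `|` c' = \top]: [c'] is a complement of [phi \top]. *)

Set Implicit Arguments.
Unset Strict Implicit.
Unset Printing Implicit Defensive.

Import Order.Theory.
Local Open Scope order_scope.

Section LatticeLemmas.
Context {d : Order.disp_t} {L : tbLatticeType d}.

(** Absorbing the kernel moves [x] into [[k, \top]], where [phi] preserves
    joins and is therefore monotone. *)
Lemma linear_le_top d' (L' : tbLatticeType d') (phi : L -> L') :
  linear_morphism phi -> forall x, phi x <= phi \top.
Proof.
move=> [k [a' [phiK [_ _ phiU]]]] x.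
have top_in : \top \in `[k, \top]%classic by rewrite inE /= in_itv /= !lex1.
have xk_in : x `|` k \in `[k, \top]%classic
  by rewrite inE /= in_itv /= leUr lex1.
by rewrite (phiK x); apply/join_idPl; rewrite joinC -phiU // joinx1.
Qed.

Lemma superfluous_complement_top (x x' : L) :
  is_complement x x' -> superfluous x -> x = \bot.
Proof. by move=> [<- xUx'] /(_ x' xUx') ->; rewrite meetx1. Qed.

(** If [x `|` y = \top] with [x <= c], the modular law gives
    [c = x `|` (y `&` c)], so smallness of [x] below [c] puts [c], and with it
    [x], below [y]. *)
Lemma superfluous_below_superfluous (c x : L) :
  modular_lattice L -> superfluous_below c x -> superfluous x.
Proof.
move=> Lmod [/=]; rewrite in_itv /= => /andP[_ le_xc] small_x y xUy.
have ycE : y `&` c = c.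
  apply: small_x; first by rewrite /= in_itv /= le0x leIr.
  by rewrite Lmod // xUy meet1x.
have le_xy : x <= y by apply: le_trans le_xc _; rewrite -ycE leIl.
by rewrite -xUy; apply/esym/join_idPr.
Qed.

Lemma superfluous_below_bot (c : L) : superfluous_below c \bot.
Proof.
by split=> [|y _]; rewrite ?join0x //= in_itv /= lexx le0x.
Qed.

End LatticeLemmas.

Theorem proposition4p3 (d : Order.disp_t) (L : tbLatticeType d)
    (Lcomplete : complete_lattice L) (Lmodular : modular_lattice L)
    (m : set (L -> L)) (m_submonoid : submonoid_with_zero m)
    (m_proj : contains_projections m) :
  dual_Rickart m <-> T_lifting m /\ T_nonsingular m.
Proof.
split=> [rickart | [lifting nonsing] phi m_phi].
  split=> phi m_phi; have [c' cc'] := rickart _ m_phi.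
    exists (phi \top), c'; split=> //.
    by rewrite cc'.1; exact: superfluous_below_bot.
  move=> /(superfluous_complement_top cc') phi1; apply/funext => x.
  apply/eqP; rewrite /lzero -lex0 -phi1.
  exact: linear_le_top (submonoid_sub m_submonoid m_phi) x.
have [c [c' [[cIc' cUc'] le_c small]]] := lifting _ m_phi.
have c'c : is_complement c' c by split; rewrite 1?meetC 1?joinC.
pose psi := lproj c' c \o phi.
have m_psi : m psi by apply: (submonoid_comp m_submonoid) => //; exact: m_proj.
have psi1 : psi \top = phi \top `&` c' by rewrite /psi /lproj /= (join_idPl le_c).
have psi0 : psi = lzero.
  apply: nonsing => //; rewrite psi1.
  exact: superfluous_below_superfluous Lmodular small.
exists c'; split; first by rewrite -psi1 psi0.
by apply/eqP; rewrite -le1x -[X in X <= _]cUc' leU2.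
Qed.
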